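(* For all $\mu \in \mathbb{R}$, $\sigma > 0$ and $1 < r < \infty$, the generalized lognormal distribution $\mathrm{GLN}(\mu,\sigma,r)$ is M-indeterminate.
   Context: For $\mu \in \mathbb{R}$, $\sigma > 0$, $r > 0$, the generalized lognormal distribution $\mathrm{GLN}(\mu,\sigma,r)$ of order $r$ is the probability distribution on $(0,\infty)$ with density $$f(x) = \frac{1}{2\, x\, r^{1/r}\, \sigma\, \Gamma(1+1/r)} \exp\left\{ -\frac{1}{r\,\sigma^r} |\ln x - \mu|^r \right\}, \quad 0 < x < \infty.$$ A probability distribution $F$ with finite moments $m_k(F) = \int x^k \, dF(x)$ of all orders $k = 1,2,\dots$ is called moment-determinate (M-det) if it is uniquely determined by the sequence of these moments, and moment-indeterminate (M-indeterminate) otherwise. Here the moment problem is of Stieltjes type (distributions on the positive half-axis $[0,\infty)$): M-indeterminacy of $F$ means that all moments of $F$ are finite and there is a probability distribution $G \neq F$ on $[0,\infty)$ with $m_k(G) = m_k(F)$ for all $k = 1,2,\dots$. *)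

(* Defs.v *)
From HB Require Import structures.
From mathcomp Require Import all_boot all_order all_algebra.
From mathcomp Require Import all_classical all_reals all_analysis.
From mathcomp Require Import measurable_realfun ring lra.

Set Implicit Arguments.
Unset Strict Implicit.
Unset Printing Implicit Defensive.

Import Order.TTheory GRing.Theory Num.Theory.
Import numFieldNormedType.Exports.

Local Open Scope classical_set_scope.
Local Open Scope ring_scope.

Definition Gamma {R : realType} (z : R) : R :=
  \int[lebesgue_measure]_(t in `]0, +oo[) (t `^ (z - 1) * expR (- t)).

(* Density of the generalized lognormal law of location m, scale s, order r. *)
Definition gln_pdf {R : realType} (m s r x : R) : R :=
  if 0 < x then
    (2 * x * r `^ r^-1 * s * Gamma (1 + r^-1))^-1
      * expR (- (r * s `^ r)^-1 * `|ln x - m| `^ r)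
  else 0.

(* The total mass of gln_pdf is computed without any change of variables: write
   exp(-u) as the integral of exp(-t) over t >= u, with u = a |ln x - m|^r, and
   exchange the integrals; the inner integral of 1/x then runs over the interval
   |ln x - m| <= (t/a)^(1/r) and equals 2 (t/a)^(1/r), which leaves the integrand
   of Gamma (1 + 1/r). *)
Section gln_mass.
Context {R : realType}.
Implicit Types (a r s m t x : R).
Local Notation mu := (@lebesgue_measure R).

Lemma int_expRN s :
  (\int[mu]_(t in `[s, +oo[) (expR (- t))%:E = (expR (- s))%:E)%E.
Proof.
have cexpN : continuous (fun z : R => expR (- z)).
  by move=> z; apply: continuous_comp; [exact: continuousN|exact: continuous_expR].
rewrite (@ge0_continuous_FTC2y _ _ (fun x => - expR (- x)) _ 0)//.
- by rewrite EFinN oppeK add0e.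
- exact: continuous_subspaceT.
- by rewrite -oppr0; apply: cvgN; exact: cvgr_expR.
- by apply: cvgN; apply/cvg_at_right_filter; exact: cexpN.
- move=> z _.
  rewrite derive1N// derive1_comp// derive1N// derive1_id mulrN1 derive1E.
  by have /funeqP -> := @derive_expR R; rewrite opprK.
Qed.

Lemma int_inv_ln m s : 0 <= s ->
  (\int[mu]_(x in `[expR (m - s)%R, expR (m + s)%R]) (expR (- ln x))%:E
     = (2 * s)%:E)%E.
Proof.
rewrite le_eqVlt => /predU1P[<-|s0].
  by rewrite subr0 addr0 mulr0 set_itv1 integral_set1.
have pos x : expR (m - s) <= x -> 0 < x.
  by apply: lt_le_trans; exact: expR_gt0.
have lnd x : 0 < x -> is_derive x 1 (@ln R) x^-1 by exact: is_derive1_ln.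
rewrite (@continuous_FTC2 _ _ (@ln R)).
- by rewrite !expRK -EFinB; congr EFin; lra.
- by rewrite ltr_expR; lra.
- apply: continuous_in_subspaceT => x.
  rewrite inE/= in_itv/= => /andP[/pos x0 _].
  apply: (@continuous_comp _ _ _ (fun x => - ln x) expR); last exact: continuous_expR.
  by apply: continuousN; exact: continuous_ln.
- split.
  + move=> x; rewrite in_itv/= => /andP[/ltW/pos x0 _].
    by have := lnd _ x0; move=> [].
  + by apply/cvg_at_right_filter; apply: continuous_ln; exact: expR_gt0.
  + by apply/cvg_at_left_filter; apply: continuous_ln; exact: expR_gt0.
- move=> x; rewrite in_itv/= => /andP[/ltW/pos x0 _].
  rewrite derive1E; have := lnd _ x0 => /@derive_val ->.
  by rewrite expRN lnK.
Qed.

Lemma measurable_expRNln : measurable_fun [set: R] (fun x : R => expR (- ln x)).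
Proof.
apply: (measurableT_comp (@measurable_expR R)).
apply: measurable_funN; exact: measurable_ln.
Qed.

Lemma powR_sublevel a r t m x : 0 < a -> 0 < r -> 0 < x -> 0 <= t ->
  (a * `|ln x - m| `^ r <= t) =
  (expR (m - (t / a) `^ r^-1) <= x <= expR (m + (t / a) `^ r^-1)).
Proof.
move=> a0 r0 x0 t0.
rewrite -[in RHS](@lnK _ x)// !ler_expR.
transitivity (`|ln x - m| <= (t / a) `^ r^-1); last first.
  by rewrite ler_norml; apply/andP/andP => -[h1 h2]; split; lra.
have ta0 : 0 <= t / a by rewrite divr_ge0// ltW.
rewrite mulrC -ler_pdivlMr//.
apply/idP/idP => h.
  have -> : `|ln x - m| = (`|ln x - m| `^ r) `^ r^-1.
    by rewrite -powRrM divff ?gt_eqF// powRr1.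
  by rewrite ge0_ler_powR// ?nnegrE ?powR_ge0// invr_ge0 ltW.
have -> : t / a = ((t / a) `^ r^-1) `^ r.
  by rewrite -powRrM mulVf ?gt_eqF// powRr1.
by rewrite ge0_ler_powR// ?nnegrE ?powR_ge0// ltW.
Qed.

Lemma int_gln_layer a r m : 0 < a -> 0 < r ->
  (\int[mu]_(x in `]0%R, +oo[) (expR (- ln x) * expR (- (a * `|ln x - m| `^ r)))%:E
   = \int[mu]_(t in `[0%R, +oo[) (expR (- t) * (2 * (t / a) `^ r^-1))%:E)%E.
Proof.
move=> a0 r0.
have h0 x : 0 <= a * `|ln x - m| `^ r by rewrite mulr_ge0 ?powR_ge0// ltW.
pose A : set (R * R) :=
  [set z | 0 < z.1] `&` [set z | a * `|ln z.1 - m| `^ r <= z.2].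
have ml : measurable_fun [set: R * R] (fun z => ln z.1).
  by apply: measurableT_comp => //; exact: measurable_ln.
have mA : measurable A.
  apply: measurableI.
    have -> : [set z : R * R | 0 < z.1] = setT `&` fst @^-1` `]0, +oo[%classic.
      by apply/seteqP; split => z /=; rewrite in_itv/= andbT//; case.
    exact: measurable_fst.
  rewrite -[X in measurable X]setTI.
  apply: measurable_fun_le => //.
  apply: measurable_funM => //.
  apply: (measurableT_comp (measurable_powR r)).
  apply: measurableT_comp => //.
  exact: measurable_funB.
pose H (z : R * R) : \bar R := (\1_A z * (expR (- ln z.1) * expR (- z.2)))%:E.
have mH : measurable_fun setT H.
  apply/measurable_EFinP; apply: measurable_funM => //.
  apply: measurable_funM; apply: measurableT_comp => //; exact: measurableT_comp.
have H0 z : (0 <= H z)%E.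
  by rewrite /H lee_fin mulr_ge0// mulr_ge0// expR_ge0.
have := @fubini_tonelli _ _ _ _ R mu mu H mH H0.
set L := LHS; set RR := RHS => LR.
transitivity L; [|rewrite LR]; rewrite ?/L ?/RR.
- rewrite integral_mkcond; apply: eq_integral => x _.
  rewrite patchE; case: ifPn => [|].
  + rewrite inE/= in_itv/= andbT => x0.
    transitivity (\int[mu]_(t in `[(a * `|ln x - m| `^ r)%R, +oo[)
        ((expR (- ln x))%:E * (expR (- t))%:E))%E.
      rewrite ge0_integralZl.
      * by rewrite int_expRN -EFinM.
      * exact: measurable_itv.
      * by apply/measurable_EFinP; apply: measurable_funTS; exact: measurableT_comp.
      * by move=> t _; rewrite lee_fin expR_ge0.
      * by rewrite lee_fin expR_ge0.
    rewrite [LHS]integral_mkcond; apply: eq_integral => t _.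
    rewrite patchE /H indicE.
    have -> : ((x, t) \in A) = (t \in `[a * `|ln x - m| `^ r, +oo[%classic).
      apply/idP/idP; rewrite !inE /A/= in_itv/= andbT.
        by move=> [].
      by move=> h; split.
    by case: ifPn => _; rewrite ?mul1r ?mul0r.
  + rewrite notin_setE/= in_itv/= andbT => x0.
    rewrite [RHS]integral0_eq; first reflexivity.
    move=> t _.
    have nA : ~ A (x, t) by move=> [/= h _]; exact: x0.
    by rewrite /H indicE (memNset nA) mul0r.
- rewrite [RHS]integral_mkcond; apply: eq_integral => t _.
  rewrite patchE; case: ifPn => [|].
  + rewrite inE/= in_itv/= andbT => t0.
    set s := (t / a) `^ r^-1.
    transitivity (\int[mu]_(x in `[expR (m - s)%R, expR (m + s)%R])
        ((expR (- t))%:E * (expR (- ln x))%:E))%E; last first.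
      rewrite ge0_integralZl.
      * by rewrite int_inv_ln ?powR_ge0// -EFinM.
      * exact: measurable_itv.
      * apply/measurable_EFinP; apply: measurable_funTS.
        exact: measurable_expRNln.
      * by move=> x _; rewrite lee_fin expR_ge0.
      * by rewrite lee_fin expR_ge0.
    rewrite [RHS]integral_mkcond; apply: eq_integral => x _.
    rewrite patchE /H indicE.
    have -> : ((x, t) \in A) = (x \in `[expR (m - s)%R, expR (m + s)%R]%classic).
      apply/idP/idP; rewrite !inE /A/= in_itv/=.
        by move=> [x0]; rewrite powR_sublevel.
      move=> h; have x0 : 0 < x.
        by case/andP: h => + _; apply: lt_le_trans; exact: expR_gt0.
      split; first exact: x0.
      by rewrite powR_sublevel.
    case: ifPn => _; last by rewrite mul0r.
    by rewrite mul1r mulrC EFinM.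
  + rewrite notin_setE/= in_itv/= andbT => t0.
    rewrite [LHS]integral0_eq; first reflexivity.
    move=> x _.
    have nA : ~ A (x, t).
      move=> [/= _ h]; apply: t0; exact: le_trans (h0 _) h.
    by rewrite /H indicE (memNset nA) mul0r.
Qed.

Lemma measurable_Gamma_integrand z :
  measurable_fun [set: R] (fun t => t `^ (z - 1) * expR (- t)).
Proof.
apply: measurable_funM; first exact: measurable_powR.
by apply: measurableT_comp => //; exact: measurableT_comp.
Qed.

Lemma powR_expR_bound p t : 0 < p -> 0 < t ->
  t `^ p <= (2 * p) `^ p * expR (t / 2).
Proof.
move=> p0 t0.
have p20 : 0 < 2 * p by rewrite mulr_gt0.
rewrite /powR !gt_eqF// -expRD ler_expR.
have /ltW : ln (t / (2 * p)) < t / (2 * p).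
  by apply: ln_sublinear; rewrite divr_gt0.
rewrite ln_div ?posrE// -(ler_pM2l p0) => h.
have e : p * (t / (2 * p)) = t / 2 by field; rewrite gt_eqF.
rewrite e in h; lra.
Qed.

Lemma integrable_Gamma_integrand z : 1 < z ->
  mu.-integrable `]0, +oo[ (fun t => (t `^ (z - 1) * expR (- t))%:E).
Proof.
move=> z1.
have p0 : 0 < z - 1 by lra.
set p := z - 1 in p0 *.
apply: (@le_integrable _ _ _ mu _ _ _
    (fun t => ((2 * p) `^ p * 2 * exponential_pdf 2^-1 t)%:E)) => //.
- apply/measurable_EFinP; apply: measurable_funTS.
  exact: measurable_Gamma_integrand.
- move=> t; rewrite /= in_itv/= andbT => t0.
  rewrite lee_fin exponential_pdfE; last exact: ltW.
  rewrite ger0_norm; last by rewrite mulr_ge0 ?powR_ge0 ?expR_ge0.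
  apply: (le_trans _ (ler_norm _)).
  apply: le_trans (ler_wpM2r (expR_ge0 _) (powR_expR_bound p0 t0)) _.
  rewrite -[leLHS]mulrA -expRD.
  have -> : t / 2 - t = - 2^-1 * t by lra.
  by rewrite mulrA -[_ * 2 * 2^-1]mulrA divff// mulr1.
- have ip : mu.-integrable `]0, +oo[ (EFin \o exponential_pdf (2^-1 : R)).
    apply: (@integrableS _ _ _ mu setT) => //.
    exact: integrable_exponential_pdf.
  have := @integrableZl _ _ _ mu _ (measurable_itv _) ((2 * p) `^ p * 2) _ ip.
  by apply: eq_integrable => // t _; rewrite EFinM.
Qed.

Lemma Gamma_EFin z : 1 < z ->
  (Gamma z)%:E =
  (\int[mu]_(t in `]0%R, +oo[) (t `^ (z - 1) * expR (- t))%:E)%E.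
Proof.
move=> z1; rewrite /Gamma /Rintegral fineK//.
by apply: integrable_fin_num => //; exact: integrable_Gamma_integrand.
Qed.

Lemma Gamma_gt0 (z : R) : 1 < z -> 0 < Gamma z.
Proof.
move=> z1; rewrite -lte_fin Gamma_EFin//.
apply: (@lt_le_trans _ _ (\int[mu]_(t in `[1%R, +oo[) (expR (- t))%:E)%E).
  by rewrite int_expRN lte_fin expR_gt0.
apply: (@le_trans _ _
    (\int[mu]_(t in `[1%R, +oo[) (t `^ (z - 1) * expR (- t))%:E)%E).
  apply: ge0_le_integral => //.
  - by apply/measurable_EFinP; apply: measurable_funTS; exact: measurableT_comp.
  - apply/measurable_EFinP; apply: measurable_funTS.
    exact: measurable_Gamma_integrand.
  - move=> t; rewrite /= in_itv/= andbT => t1.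
    rewrite lee_fin ler_peMl ?expR_ge0//.
    rewrite -[leLHS](powRr0 t); apply: ler_powR => //; rewrite subr_ge0; exact: ltW.
apply: (@ge0_subset_integral _ _ _ mu) => //.
- apply/measurable_EFinP; apply: measurable_funTS.
  exact: measurable_Gamma_integrand.
- by move=> t _; rewrite lee_fin mulr_ge0 ?powR_ge0 ?expR_ge0.
- move=> t; rewrite /= !in_itv/= !andbT => t1; lra.
Qed.

Lemma gln_pdf_ge0 m s r x : 0 < s -> 0 < r -> 0 <= gln_pdf m s r x.
Proof.
move=> s0 r0; rewrite /gln_pdf; case: ifPn => // x0.
have G0 : 0 < Gamma (1 + r^-1).
  by apply: Gamma_gt0; rewrite ltrDl invr_gt0.
by rewrite mulr_ge0 ?expR_ge0// invr_ge0 !mulr_ge0// ?powR_ge0// ltW.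
Qed.

Lemma gln_pdf_pos m s r x : 0 < x ->
  gln_pdf m s r x = (2 * r `^ r^-1 * s * Gamma (1 + r^-1))^-1 *
    (expR (- ln x) * expR (- ((r * s `^ r)^-1 * `|ln x - m| `^ r))).
Proof.
move=> x0; rewrite /gln_pdf x0 mulNr mulrA; congr (_ * _).
rewrite expRN lnK ?posrE// -invfM; congr _^-1; ring.
Qed.

Lemma gln_pdf_patch m s r : gln_pdf m s r =
  (fun x => (2 * r `^ r^-1 * s * Gamma (1 + r^-1))^-1 *
    (expR (- ln x) * expR (- ((r * s `^ r)^-1 * `|ln x - m| `^ r))))
  \_ `]0, +oo[%classic.
Proof.
apply/funext => x; rewrite patchE; case: ifPn.
  by rewrite inE/= in_itv/= andbT => /gln_pdf_pos ->.
by rewrite notin_setE/= in_itv/= andbT /gln_pdf => /negP/negbTE ->.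
Qed.

Lemma measurable_gln_core a r m :
  measurable_fun [set: R]
    (fun x => expR (- ln x) * expR (- (a * `|ln x - m| `^ r))).
Proof.
have ml := @measurable_ln R.
apply: measurable_funM; first exact: measurable_expRNln.
apply: measurableT_comp => //; apply: measurableT_comp => //.
apply: measurable_funM => //.
apply: (measurableT_comp (measurable_powR r)).
by apply: measurableT_comp => //; exact: measurable_funB.
Qed.

Lemma measurable_gln_pdf m s r : measurable_fun [set: R] (gln_pdf m s r).
Proof.
rewrite gln_pdf_patch; apply/measurable_restrict => //.
by apply: measurable_funTS; apply: measurable_funM => //;
  exact: measurable_gln_core.
Qed.

Lemma integral_gln_pdf m s r : 0 < s -> 0 < r ->
  (\int[mu]_x (gln_pdf m s r x)%:E = 1)%E.
Proof.
move=> s0 r0.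
have ri0 : 0 < r^-1 by rewrite invr_gt0.
have G0 : 0 < Gamma (1 + r^-1) by apply: Gamma_gt0; rewrite ltrDl.
have pr0 : 0 < r `^ r^-1 by exact: powR_gt0.
have ps0 : 0 < s `^ r by exact: powR_gt0.
set K := (2 * r `^ r^-1 * s * Gamma (1 + r^-1))^-1.
have K0 : 0 <= K by rewrite invr_ge0 !mulr_ge0 ?ltW.
set a := (r * s `^ r)^-1.
have a0 : 0 < a by rewrite invr_gt0 mulr_gt0.
transitivity (\int[mu]_(x in `]0%R, +oo[)
   (K%:E * (expR (- ln x) * expR (- (a * `|ln x - m| `^ r)))%:E))%E.
  rewrite [RHS]integral_mkcond; apply: eq_integral => x _.
  by rewrite gln_pdf_patch !patchE; case: ifPn.
rewrite ge0_integralZl; last 4 first.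
- exact: measurable_itv.
- by apply/measurable_EFinP; apply: measurable_funTS; exact: measurable_gln_core.
- by move=> x _; rewrite lee_fin mulr_ge0 ?expR_ge0.
- by rewrite lee_fin.
rewrite int_gln_layer//.
have aE : a^-1 `^ r^-1 = r `^ r^-1 * s.
  rewrite /a invrK powRM ?powR_ge0 ?(ltW r0)//; congr (_ * _).
  by rewrite -powRrM divff ?gt_eqF// powRr1// ltW.
transitivity (K%:E * \int[mu]_(t in `]0%R, +oo[)
   ((2 * (r `^ r^-1 * s))%:E * (t `^ (1 + r^-1 - 1) * expR (- t))%:E))%E.
  congr (_ * _)%E; rewrite -integral_itv_obnd_cbnd; last first.
    apply/measurable_EFinP; apply: measurable_funTS; apply: measurable_funM.
      by apply: measurableT_comp => //; exact: measurableT_comp.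
    apply: measurable_funM => //; apply: (measurableT_comp (measurable_powR _)).
    exact: measurable_funM.
  apply: eq_integral => t; rewrite inE/= in_itv/= andbT => t0.
  rewrite -EFinM; congr EFin.
  rewrite powRM; [rewrite aE|exact: ltW|by rewrite invr_ge0 ltW].
  have -> : 1 + r^-1 - 1 = r^-1 by ring.
  by ring.
rewrite ge0_integralZl; last 4 first.
- exact: measurable_itv.
- by apply/measurable_EFinP; apply: measurable_funTS; exact: measurable_Gamma_integrand.
- by move=> t _; rewrite lee_fin mulr_ge0 ?powR_ge0 ?expR_ge0.
- by rewrite lee_fin !mulr_ge0 ?ltW.
rewrite -Gamma_EFin ?ltrDl// -!EFinM; congr EFin.
by rewrite /K; field; rewrite !gt_eqF.
Qed.

End gln_mass.

Definition gln_prob {R : realType} (m s r : R) (A : set (measurableTypeR R)) :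
  \bar R := (\int[lebesgue_measure]_(x in A) (gln_pdf m s r x)%:E)%E.

Section gln.
Context {R : realType} (m s r : R) (s0 : 0 < s) (r0 : 0 < r).

Let gln_prob0 : gln_prob m s r set0 = 0%E.
Proof. by rewrite /gln_prob integral_set0. Qed.

Let gln_prob_ge0 A : (0 <= gln_prob m s r A)%E.
Proof. by apply: integral_ge0 => x _; rewrite lee_fin gln_pdf_ge0. Qed.

Let gln_prob_sigma_additive : semi_sigma_additive (gln_prob m s r).
Proof.
move=> /= F mF tF mUF; rewrite /gln_prob; apply: cvg_toP.
  apply: ereal_nondecreasing_is_cvgn => i j ij.
  apply: lee_sum_nneg_natr => // k _ _; apply: integral_ge0 => /= x Fkx.
  by rewrite lee_fin gln_pdf_ge0.
rewrite ge0_integral_bigcup//=.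
- by apply/measurable_EFinP; apply: measurable_funTS; exact: measurable_gln_pdf.
- by move=> x _; rewrite lee_fin gln_pdf_ge0.
Qed.

Let gln_prob_setT : gln_prob m s r [set: measurableTypeR R] = 1%E.
Proof. exact: integral_gln_pdf. Qed.

Let gln_isMeasure := isMeasure.Build _ (measurableTypeR R) R (gln_prob m s r)
  gln_prob0 gln_prob_ge0 gln_prob_sigma_additive.

Let gln_measure : {measure set (measurableTypeR R) -> \bar R} :=
  HB.pack (gln_prob m s r) gln_isMeasure.

Definition gln : probability (measurableTypeR R) R :=
  HB.pack (gln_prob m s r) gln_isMeasure
    (Measure_isProbability.Build _ _ _ gln_measure gln_prob_setT).

End gln.

Section moment_problem.
Context {R : realType}.
Implicit Types F G : probability (measurableTypeR R) R.

Definition on_half_line F : Prop := F `]-oo, 0[%classic = 0%E.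

Definition moment F (k : nat) : \bar R := (\int[F]_x (x ^+ k)%:E)%E.

Definition finite_moments F : Prop :=
  forall k, (0 < k)%N -> F.-integrable setT (fun x => (x ^+ k)%:E).

(* Indeterminacy in the Stieltjes sense. Two laws are distinct when they differ
   on a measurable set, as a measure is also a function of the nonmeasurable
   ones. *)
Definition M_indeterminate F : Prop :=
  [/\ on_half_line F, finite_moments F &
      exists G, [/\ on_half_line G,
                    forall k, (0 < k)%N -> moment G k = moment F k &
                    exists2 A, measurable A & G A <> F A]].

End moment_problem.

(* Main.v *)
(* Stieltjes' function exp(-q) sin q with q = x^(1/4) has all its moments on the
   half-line equal to 0: with x = t^4 and s(t) = exp(-t) sin t, this amounts to the
   vanishing of the integrals of t^(4k+3) s, and s^(4) = - 4 s makes four integrations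
   by parts lower k by one. Translating it to [1, +oo[ preserves this property and
   keeps the function away from 0, where the generalized lognormal density f decays
   faster than every power. Beyond 1, the translate decays like exp(-x^(1/4)), hence
   is at most C f for some constant C, so f plus the translate divided by C is the
   density of another law with the moments of f. *)
From HB Require Import structures.
Require Import Defs.
From mathcomp Require Import all_boot all_order all_algebra.
From mathcomp Require Import all_classical all_reals all_analysis.
From mathcomp Require Import measurable_realfun zify ring lra.

Set Implicit Arguments.
Unset Strict Implicit.
Unset Printing Implicit Defensive.

Import Order.TTheory GRing.Theory Num.Theory.
Import numFieldNormedType.Exports.

Local Open Scope classical_set_scope.
Local Open Scope ring_scope.

(** * Decay of t^n exp(-t), and a tool for derivatives *)

Lemma cvgr_expr_expRN (R : realType) (n : nat) :
  t ^+ n * expR (- t) @[t --> +oo] --> (0 : R).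
Proof.
(* The exponent n + 1 is positive even for n = 0, as [powR_expR_bound] requires, and t^n <= t^(n+1)
   once t >= 1. *)
have p0 : 0 < n.+1%:R :> R by rewrite ltr0n.
pose C : R := (2 * n.+1%:R) `^ n.+1%:R.
apply: (@squeeze_cvgr _ _ _ _ (fun=> 0) (fun t => C * expR (- (t / 2)))).
- near=> t.
  have t1 : 1 <= t by near: t; exact: nbhs_pinfty_ge.
  have t0 : 0 < t by exact: lt_le_trans t1.
  rewrite mulr_ge0 ?exprn_ge0 ?expR_ge0 ?(ltW t0)//=.
  have -> : - (t / 2) = t / 2 + - t by lra.
  rewrite expRD mulrA.
  rewrite ler_wpM2r ?expR_ge0//.
  apply: le_trans (powR_expR_bound p0 t0).
  by rewrite powR_mulrn ?(ltW t0)// ler_weXn2l.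
- exact: cvg_cst.
- rewrite -(mulr0 C); apply: cvgM; first exact: cvg_cst.
  have h : ((t : R) / 2) @[t --> +oo] --> +oo.
    apply/cvgryPge => A; have := nbhs_pinfty_ge (num_real (A * 2)).
    by apply: filterS => t; rewrite ler_pdivlMr.
  exact: (cvg_comp _ _ h (@cvgr_expR R)).
Unshelve. all: by end_near. Qed.

(** Serves to replace what the derivation rules produce by closed forms, leaving an algebraic
    identity. *)
Lemma eq_is_derive (R : realType) (f g : R -> R) (df dg t : R) :
  is_derive t 1 f df -> f =1 g -> df = dg -> is_derive t 1 g dg.
Proof. by move=> fdf /funext <- <-. Qed.

(** * Primitives of polynomials times exp(-t) sin t *)

Section damped_sine.
Context {R : realType}.
Implicit Types (t x : R) (k j n : nat).

Lemma cvgr_expr_expRN_bounded n (b : R -> R) : (forall t, `|b t| <= 1) ->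
  t ^+ n * (expR (- t) * b t) @[t --> +oo] --> (0 : R).
Proof.
move=> b1; apply/cvgr0Pnorm_le => e e0.
have /cvgr0Pnorm_le/(_ _ e0) := @cvgr_expr_expRN R n.
apply: filterS => t; apply: le_trans.
by rewrite mulrA normrM ler_piMr.
Qed.

(** The span of [s] and [c] is stable under differentiation: s' = c - s and c' = -(c + s), so that
    s'' = -2c and s''' = 2(c + s). *)
Let s t := expR (- t) * sin t.
Let c t := expR (- t) * cos t.

Let is_derive_s t : is_derive t 1 s (c t - s t).
Proof.
have := is_deriveM (is_derive1_comp (is_derive_expR (- t)) (is_deriveNid t 1))
  (is_derive_sin t).
by move/eq_is_derive; apply=> //; rewrite /s /c /= /GRing.scale/=; ring.
Qed.

Let is_derive_c t : is_derive t 1 c (- (c t + s t)).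
Proof.
have := is_deriveM (is_derive1_comp (is_derive_expR (- t)) (is_deriveNid t 1))
  (is_derive_cos t).
by move/eq_is_derive; apply=> //; rewrite /s /c /= /GRing.scale/=; ring.
Qed.

Let is_derive_exprM n (f : R -> R) (df : R) t : is_derive t 1 f df ->
  is_derive t 1 (fun u => u ^+ n * f u) (n%:R * t ^+ n.-1 * f t + t ^+ n * df).
Proof.
move=> fdf.
have := is_deriveM (@is_deriveX _ _ id n t 1 1 (is_derive_id t 1)) fdf.
by rewrite exprfctE; move/eq_is_derive; apply=> //; rewrite /GRing.scale/=; ring.
Qed.

(* Up to sign, t^N s''' - (t^N)' s'' + (t^N)'' s' - (t^N)''' s for N = n + 3, so that
   s^(4) = - 4 s leaves only multiples of s in its derivative. *)
Let V n t : R :=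
  n.+3%:R * n.+2%:R * n.+1%:R * (t ^+ n * s t)
  - n.+3%:R * n.+2%:R * (t ^+ n.+1 * (c t - s t))
  - n.+3%:R * (t ^+ n.+2 * (2 * c t))
  - t ^+ n.+3 * (2 * (c t + s t)).

Let is_derive_V n t : is_derive t 1 (V n)
  (4 * t ^+ n.+3 * s t
   + n.+3%:R * n.+2%:R * n.+1%:R * n%:R * (t ^+ n.-1 * s t)).
Proof.
have ds := is_derive_s t; have dc := is_derive_c t.
have d0 := is_deriveZ (n.+3%:R * n.+2%:R * n.+1%:R : R) (is_derive_exprM n ds).
have d1 := is_deriveZ (n.+3%:R * n.+2%:R : R)
  (is_derive_exprM n.+1 (is_deriveB dc ds)).
have d2 := is_deriveZ (n.+3%:R : R) (is_derive_exprM n.+2 (is_deriveZ 2 dc)).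
have d3 := is_derive_exprM n.+3 (is_deriveZ 2 (is_deriveD dc ds)).
have := is_deriveB (is_deriveB (is_deriveB d0 d1) d2) d3.
move/eq_is_derive; apply=> //.
rewrite !(addrfctE, opprfctE, scalrfctE) /GRing.scale/=.
(* The predecessor [n.-1] is truncated at n = 0, where the factor n cancels its term. *)
case: n {d0 d1 d2 d3} => [|n] /=; rewrite ?scalrfctE /GRing.scale/= !exprS; ring.
Qed.

Let cvg_V n : V n t @[t --> +oo] --> 0.
Proof.
have cc m : t ^+ m * c t @[t --> +oo] --> (0 : R).
  by apply: cvgr_expr_expRN_bounded => t; exact: cos_max.
have cs m : t ^+ m * s t @[t --> +oo] --> (0 : R).
  by apply: cvgr_expr_expRN_bounded => t; exact: sin_max.
have Z (a : R) (f : R -> R) : f t @[t --> +oo] --> (0 : R) ->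
    a * f t @[t --> +oo] --> (0 : R).
  by move=> f0; rewrite -(mulr0 a); apply: cvgM => //; exact: cvg_cst.
pose a2 : R := n.+3%:R; pose a1 : R := a2 * n.+2%:R; pose a0 : R := a1 * n.+1%:R.
have -> : V n = fun t => a0 * (t ^+ n * s t)
    + (- a1) * (t ^+ n.+1 * c t) + a1 * (t ^+ n.+1 * s t)
    + (- 2 * a2) * (t ^+ n.+2 * c t)
    + (- 2) * (t ^+ n.+3 * c t) + (- 2) * (t ^+ n.+3 * s t).
  by apply/funext => t; rewrite /V /a0 /a1 /a2; ring.
by rewrite -[0]addr0 -[X in X + 0]addr0 -[X in X + 0 + 0]addr0
  -[X in X + 0 + 0 + 0]addr0 -[X in X + 0 + 0 + 0 + 0]addr0;
  do 5?[apply: cvgD]; apply: Z.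
Qed.

(** A primitive vanishing at both ends makes the integral zero. For j = 0 the integrand is x^k times
    the wave under x = 1 + t^4, with 4 t^3 = dx/dt. General j serves the induction on k: one more
    factor 1 + t^4 splits the integrand into those for j and j + 1. *)
Lemma damped_sine_primitive j k : exists W : R -> R,
  [/\ W 0 = 0, W t @[t --> +oo] --> 0 &
      forall t, is_derive t 1 W
        (4 * t ^+ (4 * j + 3) * (1 + t ^+ 4) ^+ k * (expR (- t) * sin t))].
Proof.
elim: k j => [|k IHk] j; last first.
  have [W1 [W10 W1oo dW1]] := IHk j; have [W2 [W20 W2oo dW2]] := IHk j.+1.
  exists (W1 + W2); split.
  - by rewrite /= -[LHS]/(W1 0 + W2 0) W10 W20 addr0.
  - by rewrite -[0]addr0; exact: cvgD.
  - move=> t; apply: is_derive_eq; rewrite [_ ^+ k.+1]exprS.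
    have -> : (4 * j.+1 + 3 = 4 + (4 * j + 3))%N by lia.
    rewrite [t ^+ (4 + _)]exprD; ring.
(* With n = 4j, the derivative of [V n] is the integrand for j plus a multiple of the one for j - 1.
   At j = 0 this multiple is zero; otherwise the primitive already found cancels it. *)
elim: j => [|j [W [W0 Woo dW]]].
  exists (V 0); split => [||t].
  - by rewrite /V /s oppr0 sin0 !expr0 !exprS !(mulr0, mul0r) !subr0.
  - exact: cvg_V.
  - apply: (eq_is_derive (is_derive_V 0 t)) => //.
    by rewrite /s; ring.
pose n := (4 * j.+1)%N; pose a : R := n.+3%:R * n.+2%:R * n.+1%:R * n%:R / 4.
exists (V n - a *: W); split => [||t].
- rewrite -[LHS]/(V n 0 - a * W 0) W0 mulr0 subr0.
  by rewrite /V /s oppr0 sin0 /n mulnS !exprS !(mulr0, mul0r) !subr0.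
- rewrite -[0]subr0; apply: cvgB; first exact: cvg_V.
  by rewrite -(scaler0 _ a); apply: cvgZr.
- apply: (eq_is_derive (is_deriveB (is_derive_V n t) (is_deriveZ a (dW t)))) => //.
  have -> : n.-1 = (4 * j + 3)%N by rewrite /n; lia.
  by rewrite /GRing.scale/= expr0 -/(s t) -/n /a !addn3; field.
Qed.
End damped_sine.

(** * The translated Stieltjes function and its vanishing moments *)

Section perturbation.
Context {R : realType}.
Implicit Types (t x : R) (k n : nat).
Local Notation mu := (@lebesgue_measure R).

(** The square root of a negative number is 0 here, so [root4] is continuous across 1 and [wave]
    vanishes up to 1 without a case distinction. *)
Definition root4 x : R := Num.sqrt (Num.sqrt (x - 1)).

Definition wave x : R := expR (- root4 x) * sin (root4 x).

Lemma continuous_root4 : continuous root4.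
Proof.
move=> x; apply: (@continuous_comp _ _ _ (fun x => Num.sqrt (x - 1)) Num.sqrt).
  apply: (@continuous_comp _ _ _ (fun x => x - 1) Num.sqrt).
    by apply: continuousB; [exact: cvg_id|exact: cvg_cst].
  exact: sqrt_continuous.
exact: sqrt_continuous.
Qed.

Lemma root4_eq0 x : x <= 1 -> root4 x = 0.
Proof. by move=> x1; rewrite /root4 (@ler0_sqrtr _ (x - 1)) ?sqrtr0 ?subr_le0. Qed.

Lemma root4_gt0 x : 1 < x -> 0 < root4 x.
Proof. by move=> x1; rewrite /root4 !sqrtr_gt0 subr_gt0. Qed.

Lemma root4K x : 1 <= x -> root4 x ^+ 4 = x - 1.
Proof.
by move=> x1; rewrite -[4%N]/(2 * 2)%N exprM !sqr_sqrtr ?sqrtr_ge0 ?subr_ge0.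
Qed.

Lemma wave_eq0 x : x <= 1 -> wave x = 0.
Proof. by move=> x1; rewrite /wave root4_eq0// sin0 mulr0. Qed.

(** On ]1, 2] the argument of the sine stays in ]0, 1], hence below pi. The two laws will differ on
    this interval. *)
Lemma wave_gt0 x : 1 < x -> x <= 2 -> 0 < wave x.
Proof.
move=> x1 x2; rewrite /wave mulr_gt0 ?expR_gt0// sin_gt0_pi// root4_gt0//=.
apply: (@le_lt_trans _ _ 1); last by have := @pi_ge2 R; lra.
rewrite -(@ler_pXn2r _ 4%N) ?nnegrE ?sqrtr_ge0//.
by rewrite expr1n root4K ?(ltW x1)//; lra.
Qed.

Lemma continuous_wave : continuous wave.
Proof.
move=> x; apply: cvgM.
  apply: (@continuous_comp _ _ _ (fun x => - root4 x) expR).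
    by apply: continuousN; exact: continuous_root4.
  exact: continuous_expR.
apply: (@continuous_comp _ _ _ root4 sin); first exact: continuous_root4.
exact: continuous_sin.
Qed.

Lemma measurable_wave : measurable_fun setT wave.
Proof. exact: continuous_measurable_fun continuous_wave. Qed.

Lemma normr_wave_le x : `|wave x| <= expR (- root4 x).
Proof.
by rewrite normrM ger0_norm ?expR_ge0// ler_piMr ?expR_ge0// sin_max.
Qed.

Lemma is_derive_root4 x : 1 < x -> is_derive x 1 root4 (4 * root4 x ^+ 3)^-1.
Proof.
move=> x1; have x0 : 0 < x - 1 by rewrite subr_gt0.
have d0 : is_derive x 1 (fun u : R => u - 1) 1.
  apply: (eq_is_derive (is_deriveB (is_derive_id x 1) (is_derive_cst (1 : R) x 1))) => //.
  by rewrite subr0.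
have d1 := @is_derive1_comp _ Num.sqrt (fun u => u - 1) x _ _ (is_derive1_sqrt x0) d0.
have s0 : 0 < Num.sqrt (x - 1) by rewrite sqrtr_gt0.
have := @is_derive1_comp _ Num.sqrt (fun u => Num.sqrt (u - 1)) x _ _
  (is_derive1_sqrt s0) d1.
move/eq_is_derive; apply => //.
have q0 := root4_gt0 x1.
have -> : Num.sqrt (x - 1) = root4 x ^+ 2 by rewrite sqr_sqrtr ?sqrtr_ge0.
rewrite sqrtr_sqr gtr0_norm//.
by field; rewrite gt_eqF.
Qed.

Lemma cvg_root4_pinfty : root4 x @[x --> +oo] --> +oo.
Proof.
apply/cvgryPge => A.
have := nbhs_pinfty_ge (num_real (`|A| ^+ 4 + 1)).
apply: filterS => x Ax; apply: (le_trans (ler_norm A)).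
have A0 : 0 <= `|A| ^+ 4 by rewrite exprn_ge0.
rewrite -(@ler_pXn2r _ 4%N) ?nnegrE ?sqrtr_ge0// root4K; lra.
Qed.

(** The substitution t = [root4 x]: the factor 4 t^3 cancels against the derivative of [root4]. At
    1, where that derivative blows up, continuity suffices for the fundamental theorem of
    calculus. *)
Lemma wave_primitive k : exists W : R -> R,
  [/\ W 1 = 0, continuous W, W x @[x --> +oo] --> 0 &
      forall x, 1 < x -> is_derive x 1 W (x ^+ k * wave x)].
Proof.
have [W [W0 Woo dW]] := @damped_sine_primitive R 0 k.
exists (W \o root4); split.
- by rewrite /= root4_eq0.
- move=> x; apply: continuous_comp; first exact: continuous_root4.
  by apply: differentiable_continuous; apply/derivable1_diffP; case: (dW (root4 x)).
- exact: cvg_comp cvg_root4_pinfty Woo.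
- move=> x x1.
  have := is_derive1_comp (dW (root4 x)) (is_derive_root4 x1).
  move/eq_is_derive; apply => //.
  have q0 := root4_gt0 x1.
  rewrite muln0 add0n root4K ?ltW// addrC subrK /wave.
  by field; rewrite gt_eqF.
Qed.

(** On [1, n + 2] the integral is the value of the primitive at n + 2, which tends to 0. Dominated
    convergence, with the absolute value of the integrand as bound, passes to the whole line. *)
Lemma integral_expr_wave k :
  mu.-integrable setT (fun x => (x ^+ k * wave x)%:E) ->
  (\int[mu]_x (x ^+ k * wave x)%:E = 0)%E.
Proof.
move=> ih; have [W [W1 cW Woo dW]] := wave_primitive k.
pose g x : R := x ^+ k * wave x.
have cg : continuous g.
  by move=> x; apply: cvgM; [exact: exprn_continuous|exact: continuous_wave].
have mg : measurable_fun setT g by exact: continuous_measurable_fun.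
(* With [n.+1] the interval is nondegenerate already at n = 0. *)
pose D n := `[1, 1 + n.+1%:R]%classic : set R.
have intD n : (\int[mu]_(x in D n) (g x)%:E = (W (1 + n.+1%:R))%:E)%E.
  rewrite (@continuous_FTC2 _ g W) ?W1 ?sube0//.
  - by rewrite ltrDl ltr0n.
  - exact: continuous_subspaceT.
  - split.
    + by move=> x; rewrite in_itv/= => /andP[x1 _]; have [] := dW _ x1.
    + by apply/cvg_at_right_filter; exact: cW.
    + by apply/cvg_at_left_filter; exact: cW.
  - move=> x; rewrite in_itv/= => /andP[x1 _]; rewrite derive1E.
    by have := dW _ x1 => /@derive_val ->.
have [|||||_ _] := @dominated_convergence _ _ _ mu setT measurableT
    (fun n => (EFin \o g) \_ (D n)) (EFin \o g) (abse \o (EFin \o g)).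
- move=> n; apply: (measurable_restrictT _ (measurable_itv _)).1.
  by apply/measurable_EFinP; exact: measurable_funTS.
- exact/measurable_EFinP.
- apply: aeW => x _; apply: cvg_near_cst.
  near=> n; rewrite patchE; case: ifPn => //.
  (* A point outside [D n] is below 1, where the wave vanishes, or beyond n + 2, which fails for
     large n. *)
  rewrite notin_setE /D/= in_itv/= => /negP.
  rewrite negb_and -!ltNge => /orP[x1|].
    by rewrite /g wave_eq0 ?mulr0// ltW.
  rewrite ltNge; case/negP.
  rewrite -lerBlDl (@le_trans _ _ n%:R)// ?ler_nat//.
  by near: n; exact: nbhs_infty_ger.
- by apply/integrable_abse.
- apply: aeW => x n _; rewrite patchE; case: ifPn => // _.
  by rewrite abse0 abse_ge0.
move=> /cvg_lim <-//; apply/cvg_lim => //.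
under eq_fun do rewrite -integral_mkcond intD.
apply: cvg_EFin; first exact: nearW.
apply: (cvg_comp _ _ _ Woo).
apply/cvgryPge => A; near=> n.
rewrite (@le_trans _ _ n%:R)//; last by rewrite -natr1; lra.
by near: n; exact: nbhs_infty_ger.
Unshelve. all: by end_near. Qed.

End perturbation.

(** * Laws given by a density, and integration against them *)

Section density.
Context {R : realType}.
Local Notation mu := (@lebesgue_measure R).

Section construction.
Variable g : R -> R.
Hypotheses (mg : measurable_fun setT g) (g0 : forall x, 0 <= g x)
  (g1 : (\int[mu]_x (g x)%:E = 1)%E).

Let prob (A : set (measurableTypeR R)) : \bar R := (\int[mu]_(x in A) (g x)%:E)%E.

Let prob0 : prob set0 = 0%E.
Proof. by rewrite /prob integral_set0. Qed.

Let prob_ge0 A : (0 <= prob A)%E.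
Proof. by apply: integral_ge0 => x _; rewrite lee_fin. Qed.

Let prob_sigma_additive : semi_sigma_additive prob.
Proof.
move=> /= F mF tF mUF; rewrite /prob; apply: cvg_toP.
  apply: ereal_nondecreasing_is_cvgn => i j ij.
  by apply: lee_sum_nneg_natr => // k _ _; exact: prob_ge0.
rewrite ge0_integral_bigcup//=.
- by apply/measurable_EFinP; exact: measurable_funTS.
- by move=> x _; rewrite lee_fin.
Qed.

Let prob_isMeasure := isMeasure.Build _ (measurableTypeR R) R prob
  prob0 prob_ge0 prob_sigma_additive.

Let prob_measure : {measure set (measurableTypeR R) -> \bar R} :=
  HB.pack prob prob_isMeasure.

Let prob_probability : probability (measurableTypeR R) R :=
  HB.pack prob prob_isMeasure
    (Measure_isProbability.Build _ _ _ prob_measure g1).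

Lemma exists_probability_density : exists P : probability (measurableTypeR R) R,
  forall A, P A = (\int[mu]_(x in A) (g x)%:E)%E.
Proof.
by exists prob_probability.
Qed.

End construction.

Variables (P : probability (measurableTypeR R) R) (g : R -> R).
Hypotheses (mg : measurable_fun setT g) (g0 : forall x, 0 <= g x)
  (Pg : forall A, measurable A -> P A = (\int[mu]_(x in A) (g x)%:E)%E).

Let dominates_density : P `<< mu.
Proof.
apply/null_content_dominatesP => A mA A0.
rewrite Pg//; apply: null_set_integral => //.
by apply/measurable_EFinP; exact: measurable_funTS.
Qed.

Let integrable_density : mu.-integrable setT (EFin \o g).
Proof.
apply/integrableP; split; first exact/measurable_EFinP.
under eq_integral do rewrite gee0_abs ?lee_fin//.
by rewrite -Pg// (le_lt_trans (probability_le1 _ _))// ltry.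
Qed.

(** The Radon-Nikodym derivative of [P] equals [g] almost everywhere, both having the same integral
    over every measurable set. *)
Lemma ge0_integral_density (f : R -> \bar R) :
  measurable_fun setT f -> (forall x, 0 <= f x)%E ->
  (\int[P]_x f x = \int[mu]_x (f x * (g x)%:E))%E.
Proof.
move=> mf f0.
rewrite -(@Radon_Nikodym_SigmaFinite.change_of_variables _ _ _ P mu
  dominates_density f setT)//.
have iRN := Radon_Nikodym_SigmaFinite.f_integrable dominates_density.
apply: ae_eq_integral => //.
- by apply: emeasurable_funM => //; exact: measurable_int iRN.
- by apply: emeasurable_funM => //; exact/measurable_EFinP.
apply: ae_eqe_mul2l; apply: integral_ae_eq => //.
- exact/measurable_EFinP.
- move=> A _ mA; rewrite -Pg//.
  by rewrite -Radon_Nikodym_SigmaFinite.f_integral.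
Qed.

(** Since [g] is nonnegative, it factors out of the positive and negative parts of f g, which
    reduces the claim to nonnegative integrands. *)
Lemma integral_density (f : R -> R) : measurable_fun setT f ->
  (\int[P]_x (f x)%:E = \int[mu]_x (f x * g x)%:E)%E.
Proof.
move=> mf; have mEf : measurable_fun setT (EFin \o f) by exact/measurable_EFinP.
rewrite [LHS]integralE [RHS]integralE; congr (_ - _)%E.
- rewrite ge0_integral_density//; last exact: measurable_funepos.
  apply: eq_integral => x _; rewrite !funeposE -!EFin_max -EFinM.
  by rewrite maxr_pMl// mul0r.
- rewrite ge0_integral_density//; last exact: measurable_funeneg.
  apply: eq_integral => x _; rewrite !funenegE -!EFinN -!EFin_max -EFinM.
  by rewrite maxr_pMl// mul0r mulNr.
Qed.

Lemma integrable_density_comp (f : R -> R) : measurable_fun setT f ->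
  mu.-integrable setT (fun x => (f x * g x)%:E) ->
  P.-integrable setT (fun x => (f x)%:E).
Proof.
move=> mf /integrableP[_ fg]; apply/integrableP; split.
  exact/measurable_EFinP.
rewrite ge0_integral_density//; last first.
  by apply: measurableT_comp => //; exact/measurable_EFinP.
under eq_integral => x _.
  rewrite -(@ger0_norm _ (g x))// -EFinM -normrM.
  over.
exact: fg.
Qed.

End density.

(** * Growth estimates for the generalized lognormal density *)

Section bounds.
Context {R : realType}.
Local Notation mu := (@lebesgue_measure R).
Implicit Types (a b m r s x z : R) (k : nat).

(** Here r > 1 enters: beyond the point [M] where b z = a z^r the power dominates, and up to [M] the
    constant b M does. *)
Lemma linear_le_powR a b r : 0 < a -> 0 <= b -> 1 < r ->
  exists C, forall z, 0 <= z -> b * z <= a * z `^ r + C.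
Proof.
move=> a0 b0 r1; have ba0 : 0 <= b / a by rewrite divr_ge0// ltW.
pose M := (b / a) `^ (r - 1)^-1; have M0 : 0 <= M by exact: powR_ge0.
exists (b * M) => z z0.
have [zM|Mz] := leP z M.
  by rewrite (le_trans (ler_wpM2l b0 zM))// lerDr mulr_ge0 ?powR_ge0// ltW.
have r10 : 0 < r - 1 by rewrite subr_gt0.
have zp : 0 < z by exact: le_lt_trans Mz.
have -> : z `^ r = z `^ (r - 1) * z.
  have zn : z != 0 by rewrite gt_eqF.
  by rewrite -{1}(subrK 1 r) [LHS]powRD ?zn ?implybT// powRr1.
have h : b <= a * z `^ (r - 1).
  rewrite mulrC -ler_pdivrMr//.
  have <- : M `^ (r - 1) = b / a by rewrite /M -powRrM mulVf ?gt_eqF// powRr1.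
  by rewrite ge0_ler_powR ?nnegrE// ltW.
rewrite mulrA (le_trans (ler_wpM2r z0 h))// lerDl mulr_ge0//.
Qed.

Lemma gln_pdf_eq0 m s r x : x <= 0 -> gln_pdf m s r x = 0.
Proof. by rewrite /gln_pdf; case: ltP. Qed.

Lemma gln_const_gt0 s r : 0 < s -> 0 < r ->
  0 < (2 * r `^ r^-1 * s * Gamma (1 + r^-1))^-1.
Proof.
move=> s0 r0; rewrite invr_gt0 !mulr_gt0 ?powR_gt0//.
by apply: Gamma_gt0; rewrite ltrDl invr_gt0.
Qed.

(* Trading half of the exponent for the monomial amounts to multiplying the
   scale by 2^(1/r). *)
Lemma expr_gln_pdf_le k m s r : 0 < s -> 1 < r -> exists C, forall x,
  x ^+ k * gln_pdf m s r x <= C * gln_pdf m (2 `^ r^-1 * s) r x.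
Proof.
move=> s0 r1; have r0 : 0 < r by exact: lt_trans r1.
pose s' := 2 `^ r^-1 * s; have s'0 : 0 < s' by rewrite mulr_gt0 ?powR_gt0.
pose a := (r * s `^ r)^-1; have a0 : 0 < a by rewrite invr_gt0 mulr_gt0 ?powR_gt0.
have aE : (r * s' `^ r)^-1 = a / 2.
  rewrite /s' powRM ?powR_ge0 ?(ltW s0)// -powRrM mulVf ?gt_eqF// powRr1//.
  by rewrite /a mulrCA invfM mulrC.
have a20 : 0 < a / 2 by rewrite divr_gt0.
have [C HC] := linear_le_powR a20 (ler0n R k) r1.
have K0 := gln_const_gt0 s0 r0; have K'0 := gln_const_gt0 s'0 r0.
set K := _^-1 in K0; set K' := _^-1 in K'0.
(* [K / K'] exchanges the normalizing factors; the exponential comes from k ln x <= k |ln x - m| + k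
   m <= (a/2) |ln x - m|^r + C + k m. *)
exists (K / K' * expR (C + k%:R * m)) => x.
have [x0|x0] := leP x 0; first by rewrite !gln_pdf_eq0// !mulr0.
rewrite !gln_pdf_pos// -/s' aE -/a -/K -/K' -!expRD.
rewrite [leRHS](_ : _ = K * expR (C + k%:R * m
  + (- ln x - a / 2 * `|ln x - m| `^ r))); last first.
  by rewrite [in RHS]expRD; field; rewrite gt_eqF.
rewrite mulrCA ler_pM2l// -{1}[x]lnK// -expRM_natl -expRD ler_expR.
have := HC _ (normr_ge0 (ln x - m)).
have := ler_wpM2l (ler0n R k) (ler_norm (ln x - m)).
by rewrite mulrBr; lra.
Qed.

(** Domination by a multiple of the density with the larger scale, whose mass is 1. *)
Lemma integrable_expr_gln_pdf k m s r : 0 < s -> 1 < r ->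
  mu.-integrable setT (fun x => (x ^+ k * gln_pdf m s r x)%:E).
Proof.
move=> s0 r1; have r0 : 0 < r by exact: lt_trans r1.
have [C HC] := expr_gln_pdf_le k m s0 r1.
set s' := _ * s in HC; have s'0 : 0 < s' by rewrite mulr_gt0 ?powR_gt0.
apply: (@le_integrable _ _ _ mu setT _ _
    (fun x => C%:E * (gln_pdf m s' r x)%:E)%E).
- exact: measurableT.
- apply/measurable_EFinP; apply: measurable_funM; last exact: measurable_gln_pdf.
  exact: exprn_measurable.
- move=> x _; rewrite -EFinM lee_fin; apply: le_trans (ler_norm _).
  rewrite ger0_norm//.
  have [x0|x0] := leP x 0; first by rewrite gln_pdf_eq0// mulr0.
  by rewrite mulr_ge0 ?gln_pdf_ge0// exprn_ge0 ?ltW.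
- apply: integrableZl => //; apply/integrableP; split.
    by apply/measurable_EFinP; exact: measurable_gln_pdf.
  under eq_integral do rewrite gee0_abs ?lee_fin ?gln_pdf_ge0//.
  by rewrite integral_gln_pdf// ltry.
Qed.

(* x <= (1 + root4 x)^4, so ln x is at most logarithmic in root4 x. *)
Lemma powR_ln_le_root4 a m r : 0 < a -> 0 < r -> exists C, forall x, 1 < x ->
  ln x + a * `|ln x - m| `^ r <= root4 x + C.
Proof.
move=> a0 r0; pose E := expR (`|m| / 4); have E0 : 0 < E by exact: expR_gt0.
(* With w = exp(u/2) below, 4u <= 8w by exp y >= 1 + y, and [powR_expR_bound] bounds a (4u)^r by the
   second term times w. *)
pose D := 8 + a * 4 `^ r * (2 * r) `^ r.
exists (1 + D ^+ 2 * E / 4) => x x1.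
have q0 := root4_gt0 x1; set q := root4 x in q0 *.
have q1 : 0 < 1 + q by rewrite addr_gt0.
(* Both ln x and |ln x - m| are at most 4u, while exp(u/2) grows only like the square root of q. *)
pose u := ln (1 + q) + `|m| / 4.
have lq : 0 < ln (1 + q) by rewrite ln_gt0// ltrDl.
have u0 : 0 < u by rewrite ltr_pwDl// divr_ge0.
have lx0 : 0 < ln x by rewrite ln_gt0.
have x0 : 0 < x by exact: lt_trans x1.
have lx : ln x <= 4 * ln (1 + q).
  rewrite mulr_natl -lnXn// ler_ln ?posrE ?exprn_gt0//.
  have := root4K (ltW x1); rewrite -/q => qE.
  have -> : x = q ^+ 4 + 1 by rewrite qE subrK.
  rewrite [leRHS](_ : _ = q ^+ 4 + 1 + (4 * q ^+ 3 + 6 * q ^+ 2 + 4 * q)); last by ring.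
  by rewrite lerDl !addr_ge0// mulr_ge0// ?exprn_ge0// ltW.
have lxm : `|ln x - m| <= 4 * u.
  rewrite (le_trans (ler_normB _ _))// gtr0_norm// /u mulrDr; lra.
pose w := expR (u / 2).
have w2 : w ^+ 2 = (1 + q) * E.
  by rewrite /w -expRM_natl mulrCA divff// mulr1 /u expRD lnK// posrE.
have hw : ln x + a * `|ln x - m| `^ r <= D * w.
  rewrite /D mulrDl lerD//.
    have := expR_ge1Dx (u / 2); rewrite -/w => hw.
    have : ln x <= 4 * u by rewrite /u mulrDr; have := normr_ge0 m; lra.
    lra.
  rewrite -!mulrA ler_pM2l//.
  apply: (@le_trans _ _ ((4 * u) `^ r)).
    by rewrite ge0_ler_powR ?nnegrE ?(ltW r0)// mulr_ge0// (ltW u0).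
  rewrite powRM ?(ltW u0)// ler_pM2l ?powR_gt0//.
  exact: powR_expR_bound.
apply: (le_trans hw).
(* Expanded and divided by [E], this square gives D w <= 1 + q + D^2 E/4, whence the chosen
   constant. *)
have : 0 <= (w - D * E / 2) ^+ 2 by exact: sqr_ge0.
rewrite sqrrB w2 => h.
rewrite -(ler_pM2r E0).
have -> : (q + (1 + D ^+ 2 * E / 4)) * E = (1 + q) * E + (D * E / 2) ^+ 2 by field.
lra.
Qed.

(** Makes the perturbed density nonnegative. Beyond 1, compare exponents by [powR_ln_le_root4]; up
    to 1 the wave is zero. *)
Lemma wave_le_gln_pdf m s r : 0 < s -> 0 < r -> exists C, 0 < C /\
  forall x, `|wave x| <= C * gln_pdf m s r x.
Proof.
move=> s0 r0; have K0 := gln_const_gt0 s0 r0; set K := _^-1 in K0.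
have a0 : 0 < (r * s `^ r)^-1 by rewrite invr_gt0 mulr_gt0 ?powR_gt0.
have [C HC] := powR_ln_le_root4 m a0 r0.
exists (K^-1 * expR C); split=> [|x]; first by rewrite mulr_gt0 ?expR_gt0// invr_gt0.
have [x1|x1] := leP x 1.
  by rewrite wave_eq0// normr0 !mulr_ge0 ?gln_pdf_ge0 ?expR_ge0// invr_ge0 ltW.
rewrite (le_trans (normr_wave_le x))// gln_pdf_pos ?(lt_trans _ x1)// -/K.
rewrite mulrACA mulVf ?gt_eqF// mul1r -!expRD ler_expR.
have := HC _ x1; lra.
Qed.

End bounds.

(** * Positivity of the perturbation on ]1, 2], and the second law *)

(** Were the integral zero, the wave would vanish almost everywhere on an interval of length 1 where
    it is positive. *)
Lemma integral_wave_gt0 (R : realType) :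
  (0 < \int[lebesgue_measure]_(x in `]1%R, 2%R]) (@wave R x)%:E)%E.
Proof.
have mw : measurable_fun (`]1%R, 2%R]%classic : set R) (EFin \o @wave R).
  by apply/measurable_EFinP; apply: measurable_funTS; exact: measurable_wave.
have w0 x : `]1%R, 2%R]%classic x -> 0 < @wave R x.
  by rewrite /= in_itv/= => /andP[x1 x2]; exact: wave_gt0.
rewrite lt_neqAle integral_ge0 ?andbT; last first.
  by move=> x /w0 /ltW; rewrite lee_fin.
apply/negP => /eqP/esym i0.
have : (\int[lebesgue_measure]_(x in `]1%R, 2%R]) `|(EFin \o @wave R) x| = 0)%E.
  rewrite -i0; apply: eq_integral => x; rewrite inE => /w0 /ltW wx.
  by rewrite gee0_abs ?lee_fin.
move=> h; 
have [/(_ h) [N [mN N0 sN]] _] := ae_eq_integral_abs (@lebesgue_measure R)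
  (measurable_itv `]1, 2]) mw.
have : (lebesgue_measure (`]1%R, 2%R]%classic : set R) <= lebesgue_measure N)%E.
  apply: le_measure; [by rewrite inE; exact: measurable_itv|by rewrite inE|].
  move=> x x12; apply: sN => /(_ x12) /= [] wx0.
  by have := w0 _ x12; rewrite wx0 ltxx.
rewrite lebesgue_measure_itv/= lte_fin N0 ltr1n/= -EFinB lee_fin.
by rewrite leNgt subr_gt0 ltr1n.
Qed.

Theorem theorem2 (R : realType) (mu sigma r : R)
    (sigma_gt0 : 0 < sigma) (r_gt1 : 1 < r) :
  M_indeterminate (gln mu sigma_gt0 (lt_trans ltr01 r_gt1)).
Proof.
set r_gt0 := lt_trans ltr01 r_gt1; set F := gln _ _ _.
pose leb := @lebesgue_measure R.
have mf := @measurable_gln_pdf R mu sigma r.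
have f0 x : 0 <= gln_pdf mu sigma r x by exact: gln_pdf_ge0.
have FE A : F A = (\int[leb]_(x in A) (gln_pdf mu sigma r x)%:E)%E by [].
have iXf k := integrable_expr_gln_pdf k mu sigma_gt0 r_gt1.
have [C [C0 waveC]] := wave_le_gln_pdf mu sigma_gt0 r_gt0.
pose g x := gln_pdf mu sigma r x + C^-1 * wave x.
have mg : measurable_fun setT g.
  by apply: measurable_funD => //; apply: measurable_funM => //; exact: measurable_wave.
have g0 x : 0 <= g x.
  have := waveC x; rewrite ler_norml => /andP[+ _].
  rewrite -(ler_pM2l (_ : 0 < C^-1)) ?invr_gt0//.
  rewrite mulrN mulrA mulVf ?gt_eqF// mul1r /g; lra.
have mX k : measurable_fun setT (fun x : R => x ^+ k) by exact: exprn_measurable.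
(* Finite moments pass from the lognormal density to the wave through the bound [waveC]. *)
have iXw k : leb.-integrable setT (fun x => (x ^+ k * wave x)%:E).
  apply: (@le_integrable _ _ _ leb setT _ _
      (fun x => C%:E * (x ^+ k * gln_pdf mu sigma r x)%:E)%E).
  - exact: measurableT.
  - by apply/measurable_EFinP; apply: measurable_funM => //; exact: measurable_wave.
  - move=> x _; rewrite -EFinM lee_fin (normrM _ (wave x)) (normrM C) (gtr0_norm C0).
    rewrite (normrM _ (gln_pdf _ _ _ _)) (ger0_norm (f0 x)) [leRHS]mulrCA.
    by rewrite ler_wpM2l.
  - exact: integrableZl.
have intXg k : (\int[leb]_x (x ^+ k * g x)%:E =
    \int[leb]_x (x ^+ k * gln_pdf mu sigma r x)%:E)%E.
  transitivity (\int[leb]_x ((x ^+ k * gln_pdf mu sigma r x)%:E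
      + C^-1%:E * (x ^+ k * wave x)%:E))%E.
    by apply: eq_integral => x _; rewrite -EFinM -EFinD /g mulrDr mulrCA.
  rewrite integralD//; last exact: integrableZl.
  by rewrite integralZl// integral_expr_wave// mule0 adde0.
(* The moment of order k = 0 is the total mass. *)
have g1 : (\int[leb]_x (g x)%:E = 1)%E.
  have := intXg 0; under eq_integral do rewrite mul1r.
  move=> ->; under eq_integral do rewrite mul1r.
  exact: integral_gln_pdf.
have [G GE] := exists_probability_density mg g0 g1.
have GE' A (_ : measurable A) := GE A.
have FE' A (_ : measurable A) := FE A.
split.
- rewrite /on_half_line FE; apply: integral0_eq => x /=; rewrite in_itv/= => x0.
  by rewrite gln_pdf_eq0// ltW.
- by move=> k _; apply: (integrable_density_comp mf f0 FE').
exists G; split.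
- rewrite /on_half_line GE; apply: integral0_eq => x /=; rewrite in_itv/= => x0.
  by rewrite /g gln_pdf_eq0 ?wave_eq0 ?mulr0 ?addr0// ltW// (lt_trans x0).
- move=> k _; rewrite /moment (integral_density mg g0 GE')//.
  by rewrite (integral_density mf f0 FE').
(* Here [G] exceeds [F] by C^-1 times the positive integral of the wave, and strictly so because
   [F A] is finite. *)
pose A := `]1, 2]%classic : set R.
have mA : measurable A by exact: measurable_itv.
exists A => //.
have iA h : leb.-integrable setT (EFin \o h) -> leb.-integrable A (EFin \o h).
  by apply: integrableS => //; exact: measurable_itv.
have if1 : leb.-integrable A (EFin \o gln_pdf mu sigma r).
  by apply: iA; apply: eq_integrable (iXf 0) => // x _; rewrite mul1r.
have iw : leb.-integrable A (EFin \o wave).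
  by apply: iA; apply: eq_integrable (iXw 0) => // x _; rewrite mul1r.
have iCw : leb.-integrable A (fun x => C^-1%:E * (wave x)%:E)%E.
  exact: integrableZl.
have GFA : (G A = F A + C^-1%:E * \int[leb]_(x in A) (wave x)%:E)%E.
  by rewrite GE FE -integralZl// -integralD.
apply/eqP; rewrite GFA gt_eqF// lteDl ?fin_num_measure//.
by rewrite mule_gt0 ?integral_wave_gt0// lte_fin invr_gt0.
Qed.
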